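(* For any graphs $G$ and $H$ with no isolated vertex, $$\min\{\rho_o(G)\gamma_{t}(H),\rho_o(H)\gamma_{t}(G)\}\leq \gamma_{R}(G\times H)\leq \min\{2\gamma_t(G)\gamma_{t}(H),6\gamma(G)\gamma(H)\}.$$
   Context: All graphs are finite and simple; $N(v)$ denotes the open neighborhood. The direct product $G\times H$ has vertex set $V(G)\times V(H)$, with $(u,v)$ adjacent to $(u',v')$ iff $uu'\in E(G)$ and $vv'\in E(H)$. $\gamma(G)$ is the domination number (minimum size of a set $S$ with every vertex in $S$ or adjacent to $S$). $\gamma_t(G)$ is the total domination number (minimum size of a set $D$ such that every vertex of $G$ has a neighbor in $D$). An open packing is a set $B$ such that $N(x)\cap N(y)=\emptyset$ for all distinct $x,y\in B$; $\rho_o(G)$ is the maximum size of an open packing. A Roman dominating function on $G$ is $f:V(G)\to\{0,1,2\}$ such that every vertex with value $0$ has a neighbor with value $2$; $\gamma_R(G)$ is the minimum of $\sum_v f(v)$ over such $f$. *)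

(* Defs.v *)
From mathcomp Require Import all_boot.

Set Implicit Arguments.
Unset Strict Implicit.
Unset Printing Implicit Defensive.

Record sgraph := SGraph {
  vertex :> finType;
  adj : rel vertex;
  adj_sym : symmetric adj;
  adj_irrefl : irreflexive adj
}.

Definition opn (G : sgraph) (v : G) : {set G} := [set u | adj v u].

Definition no_isolated (G : sgraph) : Prop := forall v : G, opn v != set0.

Section DirectProduct.
Variables G H : sgraph.

Definition dprod_adj : rel (G * H) :=
  fun x y => adj x.1 y.1 && adj x.2 y.2.

Lemma dprod_adj_sym : symmetric dprod_adj.
Proof. by move=> x y; rewrite /dprod_adj adj_sym (adj_sym x.2). Qed.

Lemma dprod_adj_irrefl : irreflexive dprod_adj.
Proof. by move=> x; rewrite /dprod_adj adj_irrefl. Qed.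

Definition direct_product : sgraph :=
  SGraph dprod_adj_sym dprod_adj_irrefl.

End DirectProduct.

Section Invariants.
Variable G : sgraph.
Implicit Types S B : {set G}.

Definition dominating S : bool :=
  [forall v : G, (v \in S) || [exists u in S, adj v u]].

Definition total_dominating S : bool :=
  [forall v : G, [exists u in S, adj v u]].

Definition open_packing B : bool :=
  [forall x in B, forall y in B, (x != y) ==> [disjoint opn x & opn y]].

Definition roman_dominating (f : {ffun G -> 'I_3}) : bool :=
  [forall v : G, (f v == 0 :> nat) ==> [exists u, adj v u && (f u == 2 :> nat)]].

Definition weight (f : {ffun G -> 'I_3}) : nat := \sum_(v : G) f v.

(* The base point of an [arg min] has to be feasible for the result to be a
   true minimum; the next three lemmas establish this. *)
Lemma dominatingT : dominating setT.
Proof. by apply/forallP=> v; rewrite inE. Qed.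

(* In a graph with an isolated vertex no set is total dominating, and
   [total_domination_number] below then has the meaningless value #|G|. *)
Lemma total_dominatingT : no_isolated G -> total_dominating setT.
Proof.
move=> iso; apply/forallP=> v; have /set0Pn[u] := iso v.
by rewrite inE => vu; apply/existsP; exists u; rewrite inE.
Qed.

Lemma roman_dominating1 : roman_dominating [ffun=> inord 1].
Proof. by apply/forallP=> v; rewrite ffunE inordK. Qed.

Definition domination_number : nat :=
  #|[arg min_(S < [set: G] | dominating S) #|S|]|.

Definition total_domination_number : nat :=
  #|[arg min_(S < [set: G] | total_dominating S) #|S|]|.

Definition open_packing_number : nat :=
  \max_(B : {set G} | open_packing B) #|B|.

Definition roman_domination_number : nat :=
  weight [arg min_(f < [ffun=> inord 1] | roman_dominating f) weight f].

End Invariants.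

(* Main.v *)
Require Import Defs.
From mathcomp Require Import all_boot.

(** Lower bound: given a Roman dominating function of an isolate-free graph,
    keep the vertices of value 2 and add one neighbor of each vertex of nonzero
    value; the result is a total dominating set of size at most the weight.  And
    if [D] is a total dominating set of [G x H] and [B] an open packing of [G],
    the slices of [D] over the disjoint neighborhoods [N(x)], [x] in [B], each
    project onto a total dominating set of [H].

    Upper bounds: twice the indicator of a dominating set is Roman dominating.
    Products of total dominating sets are total dominating, and if [S], [T] are
    dominating and [u'] denotes a neighbor of [u], then the vertices [(u, v)],
    [(u', v)], [(u, v')] with [u] in [S], [v] in [T] dominate [G x H]. *)

Set Implicit Arguments.
Unset Strict Implicit.
Unset Printing Implicit Defensive.

Section Invariants.
Variable G : sgraph.
Implicit Types S B : {set G}.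

Lemma dominatingP S :
  reflect (forall v, v \in S \/ exists2 u, u \in S & adj v u) (dominating S).
Proof.
apply: (iffP forallP) => domS v; have := domS v.
  by case/orP=> [|/exists_inP]; [left | right].
by case=> [->|/exists_inP->]; rewrite ?orbT.
Qed.

Lemma total_dominatingP S :
  reflect (forall v, exists2 u, u \in S & adj v u) (total_dominating S).
Proof. by apply: (iffP forallP) => tdS v; apply/exists_inP; apply: tdS. Qed.

Lemma total_dominating_sub S S' :
  S \subset S' -> total_dominating S -> total_dominating S'.
Proof.
move=> /subsetP sSS' /total_dominatingP tdS; apply/total_dominatingP => v.
by have [u /sSS'] := tdS v; exists u.
Qed.

Lemma total_dominating_dominating S : total_dominating S -> dominating S.
Proof. by move/total_dominatingP=> tdS; apply/dominatingP => v; right. Qed.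

(** Choosing neighbors by a function makes the neighbors added to a set an image of that set, hence
    no more numerous. *)
Lemma no_isolated_neighbor :
  no_isolated G -> exists nb : G -> G, forall v, adj v (nb v).
Proof.
move=> isoG; apply: (@fin_all_exists _ _ (fun v u => adj v u)) => v.
by have /set0Pn[u] := isoG v; rewrite inE; exists u.
Qed.

Lemma domination_number_witness :
  exists2 S : {set G}, dominating S & domination_number G = #|S|.
Proof.
rewrite /domination_number; case: arg_minnP => [|S domS _].
  exact: dominatingT.
by exists S.
Qed.

Lemma total_domination_number_witness : no_isolated G ->
  exists2 S : {set G}, total_dominating S & total_domination_number G = #|S|.
Proof.
move=> isoG; rewrite /total_domination_number; case: arg_minnP => [|S tdS _].
  exact: total_dominatingT.
by exists S.
Qed.

Lemma total_domination_number_le S :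
  total_dominating S -> total_domination_number G <= #|S|.
Proof.
move=> tdS; rewrite /total_domination_number; case: arg_minnP => [|S' _].
  (* The base point [setT] of the arg min is feasible because it contains [S]. *)
  exact: total_dominating_sub (subsetT S) tdS.
exact.
Qed.

Lemma open_packing_number_witness :
  exists2 B : {set G}, open_packing B & open_packing_number G = #|B|.
Proof.
have op0 : open_packing (set0 : {set G}).
  by apply/forall_inP => x; rewrite inE.
rewrite /open_packing_number (bigmax_eq_arg _ op0).
by case: arg_maxnP => // B; exists B.
Qed.

(** The form used for counting: a vertex [g] has at most one neighbor in an open packing. *)
Lemma open_packing_disjoint B x y g :
  open_packing B -> x \in B -> y \in B -> adj x g -> adj y g -> x = y.
Proof.
move=> /forall_inP opB xB yB xg yg; apply/eqP; apply: contraT => xNy.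
have /forall_inP/(_ y yB)/implyP/(_ xNy) := opB x xB.
by move/pred0P/(_ g); rewrite !inE xg yg.
Qed.

Lemma roman_domination_number_witness :
  exists2 f : {ffun G -> 'I_3},
    roman_dominating f & roman_domination_number G = weight f.
Proof.
rewrite /roman_domination_number; case: arg_minnP => [|f rdf _].
  exact: roman_dominating1.
by exists f.
Qed.

Lemma roman_domination_number_le_dominating S :
  dominating S -> roman_domination_number G <= 2 * #|S|.
Proof.
move=> /dominatingP domS.
pose f : {ffun G -> 'I_3} := [ffun v => if v \in S then inord 2 else inord 0].
have fE v : f v = (if v \in S then 2 else 0) :> nat.
  by rewrite ffunE; case: ifP; rewrite inordK.
have -> : 2 * #|S| = weight f.
  rewrite mulnC -sum_nat_const big_mkcond.
  by apply: eq_bigr => v _; rewrite fE.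
rewrite /roman_domination_number; case: arg_minnP => [|f' _]; last first.
  apply; apply/forallP => v; rewrite fE.
  case: (domS v) => [->//|[u uS vu]]; apply/implyP => _.
  by apply/existsP; exists u; rewrite vu fE uS.
exact: roman_dominating1.
Qed.

Lemma roman_total_dominating (f : {ffun G -> 'I_3}) :
  no_isolated G -> roman_dominating f ->
  exists2 D : {set G}, total_dominating D & #|D| <= weight f.
Proof.
move=> /no_isolated_neighbor[nb nbP] /forallP rdf.
pose V12 := [set v | f v != 0 :> nat]; pose V2 := [set v | f v == 2 :> nat].
exists (V2 :|: nb @: V12).
  apply/total_dominatingP => v.
  have [v0|vN0] := eqVneq (f v : nat) 0.
    have /implyP/(_ (introT eqP v0))/existsP[u /andP[vu fu]] := rdf v.
    by exists u; rewrite // !inE fu.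
  by exists (nb v); rewrite // inE imset_f ?orbT // inE.
apply: leq_trans (leq_card_setU _ _) _.
apply: leq_trans (leq_add (leqnn _) (leq_imset_card _ _)) _.
(* The bound on [#|V2| + #|V12|] holds vertex by vertex: value 1 is counted once, in [V12], and
   value 2 twice, in both sets. *)
rewrite -!sum1_card !(big_mkcond (fun v => v \in _)) -big_split.
by apply: leq_sum => v _ /=; rewrite !inE; case: (f v) => [[|[|[]]]].
Qed.

End Invariants.

Section DirectProduct.
Variables G H : sgraph.

Lemma direct_product_no_isolated :
  no_isolated G -> no_isolated H -> no_isolated (direct_product G H).
Proof.
move=> isoG isoH [g h].
have /set0Pn[g'] := isoG g; have /set0Pn[h'] := isoH h; rewrite !inE => hh' gg'.
by apply/set0Pn; exists (g', h'); rewrite inE; apply/andP.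
Qed.

Lemma total_dominating_setX (S : {set G}) (T : {set H}) :
  total_dominating S -> total_dominating T ->
  total_dominating (setX S T : {set direct_product G H}).
Proof.
move=> /total_dominatingP tdS /total_dominatingP tdT.
apply/total_dominatingP => -[g h].
have [[u uS gu] [v vT hv]] := (tdS g, tdT h).
by exists (u, v); [rewrite in_setX uS | apply/andP].
Qed.

(** An edge of the product moves both coordinates. So if [g] is in [S] while [h] is only adjacent to
    some [v] in [T], then [(g, v)] does not dominate [(g, h)], but [(nG g, v)] does; [r] handles the
    mirror case. *)
Lemma dominating_direct_product (S : {set G}) (T : {set H}) :
  no_isolated G -> no_isolated H -> dominating S -> dominating T ->
  exists2 D : {set direct_product G H}, dominating D & #|D| <= 3 * (#|S| * #|T|).
Proof.
move=> /no_isolated_neighbor[nG nGP] /no_isolated_neighbor[nH nHP].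
move=> /dominatingP domS /dominatingP domT.
pose ST : {set direct_product G H} := setX S T.
pose l (p : direct_product G H) : direct_product G H := (nG p.1, p.2).
pose r (p : direct_product G H) : direct_product G H := (p.1, nH p.2).
have STP u v : u \in S -> v \in T -> (u, v) \in ST.
  by move=> uS vT; rewrite in_setX uS.
exists (ST :|: l @: ST :|: r @: ST).
  apply/dominatingP => -[g h].
  case: (domS g) => [gS|[u uS gu]]; case: (domT h) => [hT|[v vT hv]].
  - by left; rewrite !in_setU STP.
  - right; exists (l (g, v)); last by apply/andP.
    by rewrite !in_setU imset_f ?orbT ?STP.
  - right; exists (r (u, h)); last by apply/andP.
    by rewrite !in_setU imset_f ?orbT ?STP.
  - right; exists (u, v); last by apply/andP.
    by rewrite !in_setU STP.
rewrite -cardsX !mulSn mul0n addn0 addnA.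
apply: leq_trans (leq_card_setU _ _) _; apply: leq_add (leq_imset_card _ _).
apply: leq_trans (leq_card_setU _ _) _.
exact: leq_add (leqnn _) (leq_imset_card _ _).
Qed.

Lemma open_packing_total_dominating_le (B : {set G})
    (D : {set direct_product G H}) :
  open_packing B -> total_dominating D ->
  #|B| * total_domination_number H <= #|D|.
Proof.
move=> opB /total_dominatingP tdD.
pose slice x : {set direct_product G H} := [set p in D | adj x p.1].
(* A neighbor of [(x, h)] in [D] lies in [slice x], and its second coordinate is adjacent to [h]. *)
have slice_ge x : total_domination_number H <= #|slice x|.
  apply: leq_trans (leq_imset_card (fun p : direct_product G H => p.2) _).
  apply: total_domination_number_le; apply/total_dominatingP => h.
  have [p pD /andP[/= xp hp]] := tdD (x, h).
  by exists p.2 => //; apply/imset_f; rewrite inE pD.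
rewrite -sum_nat_const; apply: (@leq_trans (\sum_(x in B) #|slice x|)).
  by apply: leq_sum => x _; exact: slice_ge.
rewrite -sum1_card.
under eq_bigr => x _ do rewrite -sum1_card big_mkcond.
(* Double counting: it remains to see that each [p] in [D] lies in at most one slice over [B], and
   each other [p] in none. *)
rewrite exchange_big [leqRHS]big_mkcond; apply: leq_sum => p _.
rewrite -big_mkcondr sum1_card.
have sliceE x : p \in slice x = (p \in D) && adj x p.1 by rewrite inE.
have [pD|pND] := boolP (p \in D); last first.
  by rewrite eq_card0 // => x; rewrite unfold_in sliceE (negPf pND) andbF.
apply/card_le1P => x; rewrite unfold_in sliceE => /and3P[xB _ xp] y.
rewrite unfold_in sliceE inE; apply/and3P/eqP => [[yB _ yp]|->//].
exact: open_packing_disjoint opB yB xB yp xp.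
Qed.

End DirectProduct.

Theorem theorem2p5 (G H : sgraph) (isoG : no_isolated G) (isoH : no_isolated H) :
  minn (open_packing_number G * total_domination_number H)
       (open_packing_number H * total_domination_number G)
    <= roman_domination_number (direct_product G H)
    <= minn (2 * total_domination_number G * total_domination_number H)
            (6 * domination_number G * domination_number H).
Proof.
apply/andP; split.
  (* The minimum is at most its first product, and that product is bounded by the Roman domination
     number. *)
  apply: leq_trans (geq_minl _ _) _.
  have [B opB ->] := open_packing_number_witness G.
  have [f rdf ->] := roman_domination_number_witness (direct_product G H).
  have isoGH := direct_product_no_isolated isoG isoH.
  have [D tdD] := roman_total_dominating isoGH rdf.
  exact: leq_trans (open_packing_total_dominating_le opB tdD).
rewrite leq_min; apply/andP; split.
  have [S tdS ->] := total_domination_number_witness isoG.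
  have [T tdT ->] := total_domination_number_witness isoH.
  rewrite -mulnA -cardsX.
  apply/roman_domination_number_le_dominating/total_dominating_dominating.
  exact: total_dominating_setX.
have [S domS ->] := domination_number_witness G.
have [T domT ->] := domination_number_witness H.
have [D domD leD] := dominating_direct_product isoG isoH domS domT.
apply: leq_trans (roman_domination_number_le_dominating domD) _.
(* In 6, the factor 2 is the value given to each vertex of [D], and the factor 3 counts the copies
   of the product of [S] and [T] that form [D]. *)
by rewrite -[leqRHS]mulnA -[6]/(2 * 3) -[leqRHS]mulnA leq_mul2l.
Qed.
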